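(* Let $S$ be a von Neumann regular and right self-injective ring of characteristic $n$. Let $S'$ be the image of the ring homomorphism $\mathbb{Z}_n[\mathrm{Aut}(S)]\to S$ sending each element of $\mathrm{Aut}(S)$ to the corresponding element of $S$. Then $S'$ is also a von Neumann regular ring.
   Context: Rings are associative with identity. $\mathrm{Aut}(S)$ denotes the group of units of $S$. The characteristic of $S$ is the integer $n\ge 0$ such that the kernel of the canonical ring homomorphism $\mathbb{Z}\to S$, $1\mapsto 1_S$, is $n\mathbb{Z}$. $\mathbb{Z}_n=\mathbb{Z}/n\mathbb{Z}$ and $\mathbb{Z}_0=\mathbb{Z}$; $\mathbb{Z}_n[\mathrm{Aut}(S)]$ is the group ring. Thus $S'$ is the subring of $S$ consisting of the elements which can be written as finite sums of units of $S$. *)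

(* Defs.v *)
From HB Require Import structures.
From mathcomp Require Import all_boot all_order all_algebra.
From mathcomp Require Import finmap monalg boolp.

Set Implicit Arguments.
Unset Strict Implicit.
Unset Printing Implicit Defensive.

Import GRing.Theory.
Local Open Scope ring_scope.

(* Rings are pzRingTypes: associative with identity, the zero ring allowed. *)

Definition von_neumann_regular (R : pzRingType) : Prop :=
  forall a : R, exists b : R, a * b * a = a.

Definition injective_module (R : pzRingType) (E : lmodType R) : Prop :=
  forall (M N : lmodType R) (i : {linear M -> N}) (f : {linear M -> E}),
    injective i -> exists g : {linear N -> E}, forall x, g (i x) = f x.

(* Right modules over S are left modules over the converse ring S^c, and S^c^o
   is S acting on itself by a *: x = x * a (product in S). *)
Definition right_self_injective (S : pzRingType) : Prop :=
  @injective_module S^c (S^c^o : lmodType S^c).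

Definition has_characteristic (S : pzRingType) (n : nat) : Prop :=
  forall m : int, m%:~R = 0 :> S <-> (n %| m)%Z.

(* Z/nZ for every n >= 0, on canonical representatives.  Since (x %% 0)%Z = x,
   the case n = 0 is Z itself; n = 1 is the zero ring ('Z_n would be wrong in
   both cases). *)
Record residue (n : nat) := Residue {
  residue_val :> int;
  residueP : (residue_val %% n)%Z == residue_val
}.
HB.instance Definition _ n := [isSub for @residue_val n].
HB.instance Definition _ n := [Choice of residue n by <:].

Section ResidueRing.
Variable n : nat.
Implicit Types x y z : residue n.

Fact red_subproof (m : int) : ((m %% n)%Z %% n)%Z == (m %% n)%Z.
Proof. by rewrite modz_mod. Qed.

Definition red (m : int) : residue n := Residue (red_subproof m).

Lemma val_red m : val (red m) = (m %% n)%Z. Proof. by []. Qed.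

Lemma residueE x : (residue_val x %% n)%Z = x.
Proof. exact/eqP/residueP. Qed.

Definition res_add x y := red (residue_val x + residue_val y).
Definition res_opp x := red (- residue_val x).
Definition res_mul x y := red (residue_val x * residue_val y).

Fact res_addA : associative res_add.
Proof. by move=> x y z; apply: val_inj; rewrite /= modzDmr modzDml addrA. Qed.
Fact res_addC : commutative res_add.
Proof. by move=> x y; apply: val_inj; rewrite /= addrC. Qed.
Fact res_add0 : left_id (red 0) res_add.
Proof. by move=> x; apply: val_inj; rewrite /= modzDml add0r residueE. Qed.
Fact res_addN : left_inverse (red 0) res_opp res_add.
Proof. by move=> x; apply: val_inj; rewrite /= modzDml addNr. Qed.
Fact res_mulA : associative res_mul.
Proof. by move=> x y z; apply: val_inj; rewrite /= modzMmr modzMml mulrA. Qed.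
Fact res_mulC : commutative res_mul.
Proof. by move=> x y; apply: val_inj; rewrite /= mulrC. Qed.
Fact res_mul1 : left_id (red 1) res_mul.
Proof. by move=> x; apply: val_inj; rewrite /= modzMml mul1r residueE. Qed.
Fact res_mulr1 : right_id (red 1) res_mul.
Proof. by move=> x; rewrite res_mulC res_mul1. Qed.
Fact res_mulDl : left_distributive res_mul res_add.
Proof.
by move=> x y z; apply: val_inj; rewrite /= modzMml modzDmr modzDml mulrDl.
Qed.
Fact res_mulDr : right_distributive res_mul res_add.
Proof. by move=> x y z; rewrite -!(res_mulC _ x) -res_mulDl. Qed.

HB.instance Definition _ := GRing.isPzRing.Build (residue n)
  res_addA res_addC res_add0 res_addN
  res_mulA res_mul1 res_mulr1 res_mulDl res_mulDr.
HB.instance Definition _ :=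
  GRing.PzRing_hasCommutativeMul.Build (residue n) res_mulC.
End ResidueRing.

(* Aut(S): a unit is carried together with its (unique) two-sided inverse, so
   the components of a unit are the unit itself and its inverse. *)
Record units (S : pzRingType) := Units {
  unit_pair : S * S;
  unit_pairP :
    (unit_pair.1 * unit_pair.2 == 1) && (unit_pair.2 * unit_pair.1 == 1)
}.
HB.instance Definition _ S := [isSub for @unit_pair S].
HB.instance Definition _ S := [Choice of units S by <:].

Section UnitGroup.
Variable S : pzRingType.
Implicit Types u v w : units S.

Definition unit_val u : S := (unit_pair u).1.
Definition unit_inv u : S := (unit_pair u).2.

Lemma unit_valV u : unit_val u * unit_inv u = 1.
Proof. by case/andP: (unit_pairP u) => /eqP. Qed.
Lemma unit_Vval u : unit_inv u * unit_val u = 1.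
Proof. by case/andP: (unit_pairP u) => _ /eqP. Qed.

Lemma unit_val_inj : injective unit_val.
Proof.
move=> u v e; apply: val_inj.
have e' : unit_inv u = unit_inv v.
  by rewrite -[LHS]mulr1 -(unit_valV v) -e mulrA unit_Vval mul1r.
by move: e e'; rewrite /unit_val /unit_inv /=;
   case: (unit_pair u) (unit_pair v) => [? ?] [? ?] /= -> ->.
Qed.

Definition mk_unit (x y : S) (xy : x * y = 1) (yx : y * x = 1) : units S :=
  @Units S (x, y) (introT andP (conj (introT eqP xy) (introT eqP yx))).

Fact units_mul_subproof u v :
  (unit_val u * unit_val v) * (unit_inv v * unit_inv u) = 1.
Proof. by rewrite mulrA -(mulrA (unit_val u)) unit_valV mulr1 unit_valV. Qed.
Fact units_mulV_subproof u v :
  (unit_inv v * unit_inv u) * (unit_val u * unit_val v) = 1.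
Proof. by rewrite mulrA -(mulrA (unit_inv v)) unit_Vval mulr1 unit_Vval. Qed.

Definition units_one : units S := mk_unit (mulr1 1) (mulr1 1).
Definition units_mul u v : units S :=
  mk_unit (units_mul_subproof u v) (units_mulV_subproof u v).
Definition units_inv u : units S := mk_unit (unit_Vval u) (unit_valV u).

Fact units_mulA : associative units_mul.
Proof. by move=> u v w; apply: unit_val_inj; apply: mulrA. Qed.
Fact units_mul1 : left_id units_one units_mul.
Proof. by move=> u; apply: unit_val_inj; apply: mul1r. Qed.
Fact units_mulr1 : right_id units_one units_mul.
Proof. by move=> u; apply: unit_val_inj; apply: mulr1. Qed.
Fact units_mulV : left_inverse units_one units_inv units_mul.
Proof. by move=> u; apply: unit_val_inj; apply: unit_Vval. Qed.
Fact units_mulrV : right_inverse units_one units_inv units_mul.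
Proof. by move=> u; apply: unit_val_inj; apply: unit_valV. Qed.

HB.instance Definition _ := isGroup.Build (units S)
  units_mulA units_mul1 units_mulr1 units_mulV units_mulrV.
End UnitGroup.

(* The group ring R[G]: finitely supported functions G -> R with convolution.
   monalg only puts a product on {malg R[K]} for monoids K without nontrivial
   units, so just its additive structure is reused. *)
Definition group_ring (R : pzRingType) (G : groupType) : Type := {malg R[G]}.
HB.instance Definition _ R G := GRing.Zmodule.on (group_ring R G).

(* Locked: unification otherwise unfolds the product and may not terminate in
   reasonable time. *)
HB.lock Definition gr_mul (R : pzRingType) (G : groupType)
    (f g : group_ring R G) : group_ring R G :=
  \sum_(k <- msupp f) \sum_(l <- msupp g) << f@_k * g@_l *g (k * l)%g >>.
Canonical gr_mul_unlockable := Unlockable gr_mul.unlock.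

Section GroupRing.
Variables (R : pzRingType) (G : groupType).
Local Notation RG := (group_ring R G).
Local Notation gr_mul := (@gr_mul R G).
Implicit Types (f g h : RG) (k l : G) (a b : R).

Definition gr_one : RG := << (1 : R) *g 1%g >>.

Lemma gr_mulw (d1 d2 : {fset G}) f g :
    (msupp f `<=` d1)%fset -> (msupp g `<=` d2)%fset ->
  gr_mul f g = \sum_(k <- d1) \sum_(l <- d2) << f@_k * g@_l *g (k * l)%g >>.
Proof.
move=> le1 le2; rewrite unlock (big_fset_incl _ le1) /=.
  apply/eq_bigr=> k _; apply/big_fset_incl => // l _ /mcoeff_outdom ->.
  by rewrite mulr0 monalgU0.
move=> k _ /mcoeff_outdom fk.
by rewrite big1 // => l _; rewrite fk mul0r monalgU0.
Qed.

Lemma gr_mulUU a b k l :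
  gr_mul << a *g k >> << b *g l >> = << a * b *g (k * l)%g >>.
Proof. by rewrite (gr_mulw msuppU_le msuppU_le) !big_seq_fset1 !mcoeffUU. Qed.

Fact gr_mulDl : left_distributive gr_mul +%R.
Proof.
move=> f1 f2 g.
rewrite (gr_mulw (msuppD_le f1 f2) (fsubset_refl _)).
rewrite (gr_mulw (fsubsetUl (msupp f1) (msupp f2)) (fsubset_refl _)).
rewrite (gr_mulw (fsubsetUr (msupp f1) (msupp f2)) (fsubset_refl _)).
rewrite -big_split; apply/eq_bigr=> k _.
rewrite -big_split; apply/eq_bigr=> l _.
by rewrite mcoeffD mulrDl monalgUD.
Qed.

Fact gr_mulDr : right_distributive gr_mul +%R.
Proof.
move=> g f1 f2.
rewrite (gr_mulw (fsubset_refl _) (msuppD_le f1 f2)).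
rewrite (gr_mulw (fsubset_refl _) (fsubsetUl (msupp f1) (msupp f2))).
rewrite (gr_mulw (fsubset_refl _) (fsubsetUr (msupp f1) (msupp f2))).
rewrite -big_split; apply/eq_bigr=> k _.
rewrite -big_split; apply/eq_bigr=> l _.
by rewrite mcoeffD mulrDr monalgUD.
Qed.

Fact gr_mul0g : left_zero 0 gr_mul.
Proof. by move=> f; rewrite unlock msupp0 big_seq_fset0. Qed.
Fact gr_mulg0 : right_zero 0 gr_mul.
Proof.
by move=> f; rewrite unlock msupp0 big1 // => k _; rewrite big_seq_fset0.
Qed.

Lemma gr_ind (P : RG -> Prop) :
    P 0 -> (forall f g, P f -> P g -> P (f + g)) ->
    (forall a k, P << a *g k >>) ->
  forall f, P f.
Proof. by move=> P0 PD PU f; rewrite [f]monalgE; elim/big_ind: _. Qed.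

Fact gr_mulA : associative gr_mul.
Proof.
move=> f g h; elim/gr_ind: f => [|f1 f2 e1 e2|a k].
- by rewrite !gr_mul0g.
- by rewrite !gr_mulDl e1 e2.
elim/gr_ind: g => [|g1 g2 e1 e2|b l].
- by rewrite gr_mul0g !gr_mulg0 gr_mul0g.
- by rewrite gr_mulDl !gr_mulDr gr_mulDl e1 e2.
elim/gr_ind: h => [|h1 h2 e1 e2|c m].
- by rewrite !gr_mulg0.
- by rewrite !gr_mulDr e1 e2.
by rewrite !gr_mulUU mulrA mulgA.
Qed.

Fact gr_mul1 : left_id gr_one gr_mul.
Proof.
elim/gr_ind=> [|f1 f2 e1 e2|a k]; first exact: gr_mulg0.
  by rewrite gr_mulDr e1 e2.
by rewrite gr_mulUU mul1r mul1g.
Qed.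

Fact gr_mulr1 : right_id gr_one gr_mul.
Proof.
elim/gr_ind=> [|f1 f2 e1 e2|a k]; first exact: gr_mul0g.
  by rewrite gr_mulDl e1 e2.
by rewrite gr_mulUU mulr1 mulg1.
Qed.

HB.instance Definition _ := GRing.Zmodule_isPzRing.Build RG
  gr_mulA gr_mul1 gr_mulr1 gr_mulDl gr_mulDr.
End GroupRing.

Section UnitEval.
Variables (S : pzRingType) (n : nat) (charS : has_characteristic S n).
Local Notation ZU := (group_ring (residue n) (units S)).
Implicit Types (f g : ZU).

(* A coefficient acts on S through its integer representative.  The unused
   hypothesis on the characteristic is what makes this a ring homomorphism, and
   it is an argument so that the rmorphism instance below can depend on it. *)
Definition unit_eval of has_characteristic S n := fun f : ZU =>
  \sum_(u <- msupp f) unit_val u *~ residue_val f@_u.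

Local Notation phi := (unit_eval charS).

Fact mulrz_red (x : S) (m : int) : x *~ red n m = x *~ m.
Proof.
have kill : ((m %/ n)%Z * n)%:~R = 0 :> S.
  by apply: (iffRL (charS _)); exact: (dvdz_mull _ (dvdzz n)).
have -> : x *~ m = x *~ ((m %/ n)%Z * n) + x *~ (m %% n)%Z.
  by rewrite -mulrzDr -divz_eq.
by rewrite -(mulrzl x (_ * _)) kill mul0r add0r.
Qed.

Fact unit_evalw (d : {fset units S}) f : (msupp f `<=` d)%fset ->
  phi f = \sum_(u <- d) unit_val u *~ residue_val f@_u.
Proof.
move=> le; rewrite /unit_eval (big_fset_incl _ le) //= => u _ /mcoeff_outdom ->.
exact: etrans (mulrz_red (unit_val u) 0) (mulr0z _).
Qed.

Fact unit_evalD f g : phi (f + g) = phi f + phi g.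
Proof.
rewrite (unit_evalw (msuppD_le f g)) (unit_evalw (fsubsetUl _ (msupp g))).
rewrite (unit_evalw (fsubsetUr (msupp f) _)) -big_split; apply: eq_bigr => u _.
by rewrite mcoeffD mulrz_red mulrzDr.
Qed.

Fact unit_eval0 : phi 0 = 0.
Proof. by rewrite /unit_eval msupp0 big_seq_fset0. Qed.

Fact unit_evalU (a : residue n) u : phi << a *g u >> = unit_val u *~ a.
Proof. by rewrite (unit_evalw msuppU_le) big_seq_fset1 mcoeffUU. Qed.

Lemma unit_eval_unit u : phi << 1 *g u >> = unit_val u.
Proof. by rewrite unit_evalU mulrz_red mulr1z. Qed.

Fact unit_eval_nmod_morphism : nmod_morphism phi.
Proof. by split; [apply: unit_eval0 | apply: unit_evalD]. Qed.

Fact unit_eval_monoid_morphism : GRing.monoid_morphism phi.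
Proof.
split=> [|f g]; first exact: unit_eval_unit.
elim/gr_ind: f => [|f1 f2 e1 e2|a u].
- by rewrite mul0r unit_eval0 mul0r.
- have -> : (f1 + f2) * g = f1 * g + f2 * g := mulrDl f1 f2 g.
  by rewrite (unit_evalD (f1 * g) (f2 * g)) e1 e2 (unit_evalD f1 f2) mulrDl.
elim/gr_ind: g => [|g1 g2 e1 e2|b v].
- by rewrite mulr0 unit_eval0 mulr0.
- set f := (<<_ *g u>> : ZU) in e1 e2 *.
  have -> : f * (g1 + g2) = f * g1 + f * g2 := mulrDr f g1 g2.
  by rewrite (unit_evalD (f * g1) (f * g2)) e1 e2 (unit_evalD g1 g2) mulrDr.
rewrite [X in phi X](gr_mulUU a b u v) !unit_evalU mulrz_red.
by rewrite mulrzAr mulrzAl -mulrzA mulrC.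
Qed.

HB.instance Definition _ :=
  GRing.isNmodMorphism.Build ZU S phi unit_eval_nmod_morphism.
HB.instance Definition _ :=
  GRing.isMonoidMorphism.Build ZU S phi unit_eval_monoid_morphism.
End UnitEval.

Section RingImage.
Variables (R S : pzRingType) (f : {rmorphism R -> S}).

Definition in_image : pred S := fun y => `[< exists x, f x = y >].

Fact in_image_subring : subring_closed in_image.
Proof.
split=> [|_ _ /asboolP[x <-] /asboolP[y <-]|_ _ /asboolP[x <-] /asboolP[y <-]].
- by apply/asboolP; exists 1; rewrite rmorph1.
- by apply/asboolP; exists (x - y); rewrite rmorphB.
- by apply/asboolP; exists (x * y); rewrite rmorphM.
Qed.

Record ring_image := RingImage {
  ring_image_val :> S;
  ring_imageP : in_image ring_image_val
}.
HB.instance Definition _ := [isSub for ring_image_val].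
HB.instance Definition _ := [Choice of ring_image by <:].
HB.instance Definition _ :=
  GRing.SubChoice_isSubPzRing.Build S in_image ring_image in_image_subring.
End RingImage.

(* The image of Z_n[Aut(S)] -> S, a ring with the operations of S. *)
Definition units_subring (S : pzRingType) (n : nat)
    (charS : has_characteristic S n) : pzRingType :=
  ring_image (unit_eval charS).

(* Main.v *)
Require Import Defs.
From mathcomp Require Import all_boot all_order all_algebra.
From HB Require Import structures.
From mathcomp Require Import boolp classical_sets.

(* Let K be the kernel of left multiplication by a and C a complement of aS.
   A maximal isomorphism between a summand of K and a summand of C leaves
   complements k'S and c'S with c'Sk' = 0, and a central idempotent e then
   separates k' from c'.  Combining this isomorphism with a quasi-inverse of a
   gives b with aba = a which is left invertible on eS and right invertible on
   (1 - e)S, so b is a product of two one-sided invertible elements.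

   If yx = 1, then x and y act as the two shifts on the injective hull gS of the
   direct sum of the x^i(1 - xy)S, and as mutually inverse maps on S/gS.  Each
   shift differs by an element of square zero from the involution that swaps
   the (2i)-th and (2i+1)-st summands, so x and y both have the form u + v - 1
   with u and v units.  Hence b lies in S'. *)

Set Implicit Arguments.
Unset Strict Implicit.
Unset Printing Implicit Defensive.

Import GRing.Theory.
Local Open Scope ring_scope.
Local Open Scope classical_set_scope.

(** * Submodules maximal among those avoiding a set *)

Definition submodule (R : pzRingType) (V : lmodType R) (N : set V) : Prop :=
  N 0 /\ forall a x y, N x -> N y -> N (a *: x + y).

Lemma maximal_submodule_avoiding (R : pzRingType) (V : lmodType R)
    (B : set V) : ~ B 0 ->
  exists N : set V, [/\ submodule N, forall x, N x -> ~ B x &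
    forall x, ~ N x -> exists a y, N y /\ B (a *: x + y)].
Proof.
move=> B0.
(* [lin] does not ask for 0, since the empty chain in Zorn's lemma has empty union. A maximal set is
   nonempty all the same, because [[set 0]] also satisfies [P]. *)
pose lin (A : set V) := forall a x y, A x -> A y -> A (a *: x + y).
pose P (A : set V) := lin A /\ forall x, A x -> ~ B x.
have [F PF totF|N [[linN NB] maxN]] := @Zorn_bigcup V P.
  split=> [a x y [X FX Xx] [Y FY Yy]|x [X FX Xx]]; last exact: (PF X FX).2.
  have [XY|YX] := totF X Y FX FY.
    by exists Y => //; apply: (PF Y FY).1 => //; apply: XY.
  by exists X => //; apply: (PF X FX).1 => //; apply: YX.
have N0 : N 0.
  have [[x Nx]|N_empty] := pselect (exists x, N x).
    by rewrite -[0](addNr x) -scaleN1r; apply: linN.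
  have := maxN [set 0]; case; first split.
  - by move=> x Nx; case: N_empty; exists x.
  - by move=> /(_ 0 erefl) N0; case: N_empty; exists 0.
  by split=> [a x y -> ->|x ->]; rewrite ?scaler0 ?addr0.
exists N; split=> // x Nx; apply: contrapT => avoid.
apply: (maxN [set z | exists a y, N y /\ z = a *: x + y]).
  split=> [y Ny|/(_ x) sub]; first by exists 0, y; rewrite scale0r add0r.
  by apply: Nx; apply: sub; exists 1, 0; rewrite scale1r addr0.
split=> [a _ _ [b [y [Ny ->]]] [c [z [Nz ->]]]|_ [a [y [Ny ->]]] By].
  exists (a * b + c), (a *: y + z); split; first exact: linN.
  by rewrite scalerDr scalerDl scalerA addrACA.
by apply: avoid; exists a, y.
Qed.

Section SubmoduleType.
Variables (R : pzRingType) (V : lmodType R) (N : set V).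
Hypothesis subN : submodule N.

(* The module laws depend on [subN], so it must occur in the type for the
   instances below to be inferred. *)
Definition mem_submodule of submodule N : pred V := fun x => `[< N x >].

Fact mem_submodule_closed : GRing.submod_closed (mem_submodule subN).
Proof.
case: subN => N0 linN; split=> [|a x y /asboolP Nx /asboolP Ny].
  exact/asboolP.
by apply/asboolP; apply: linN.
Qed.

Record submod := Submod {
  submod_val :> V;
  submod_valP : mem_submodule subN submod_val
}.
HB.instance Definition _ := [isSub for submod_val].
HB.instance Definition _ := [Choice of submod by <:].
HB.instance Definition _ :=
  GRing.SubChoice_isSubLmodule.Build R V (mem_submodule subN) submod
    mem_submodule_closed.
End SubmoduleType.

(** * Units from block triangular elements *)

Lemma block_triangular_unit_sum (S : pzRingType) (g A m m' : S) :
    g * g = g -> g * A = A -> A * g = A -> A * A = g ->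
    m * g = g * m * g -> m' * g = g * m' * g ->
    (1 - g) * (m * m') * (1 - g) = 1 - g ->
    (1 - g) * (m' * m) * (1 - g) = 1 - g ->
    (m * g - A) * (m * g - A) = 0 ->
  exists u v : units S, m = unit_val u + unit_val v - 1.
Proof.
(* m = W + (1 + M) - 1 with W = A + m h block triangular, where h = 1 - g. *)
move=> gg gA Ag AA mg m'g; set h := 1 - g => hmm'h hm'mh.
set M := m * g - A => MM.
have hg : h * g = 0 by rewrite mulrBl mul1r gg subrr.
have gh : g * h = 0 by rewrite mulrBr mulr1 gg subrr.
have hh : h * h = h by rewrite {1}/h mulrBl mul1r gh subr0.
have gDh : g + h = 1 by rewrite addrC subrK.
have Ah : A * h = 0 by rewrite -Ag -mulrA gh mulr0.
have hA : h * A = 0 by rewrite -gA mulrA hg mul0r.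
have hblock a b : a * g = g * a * g -> h * a * (h * (b * h)) = h * (a * b) * h.
  move=> ag; rewrite mulrA {2}/h mulrBr mulr1 -(mulrA h a g) ag !mulrA hg.
  by rewrite !mul0r subr0.
pose X := h * (m' * h).
have XA : X * A = 0 by rewrite /X -!mulrA hA !mulr0.
have AX : A * X = 0 by rewrite /X mulrA Ah mul0r.
have hmX : h * m * X = h by rewrite hblock.
have Xmh : X * (m * h) = h.
  by rewrite -[RHS]hm'mh -(hblock m' m) // /X !mulrA.
have hX : h * X = X by rewrite /X mulrA hh.
clearbody X.
have hXA : h * (X - A * (m * X)) = X.
  by rewrite mulrBr hX (mulrA h A) hA mul0r subr0.
have AXA : A * (X - A * (m * X)) = - (g * (m * X)).
  by rewrite mulrBr AX sub0r mulrA AA.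
(* The diagonal blocks of [W] are [A], its own inverse on [g S], and [h m h], inverted by [X];
   [- A m X] is the off-diagonal block of the inverse. *)
have WW' : (A + m * h) * (A + (X - A * (m * X))) = 1.
  rewrite mulrDl (mulrDr A) (mulrDr (m * h)) AA AXA -!(mulrA m h) hA.
  rewrite mulr0 add0r hXA.
  by rewrite -addrA [- _ + _]addrC -{1}[m * X]mul1r -mulrBl mulrA hmX.
have W'W : (A + (X - A * (m * X))) * (A + m * h) = 1.
  rewrite mulrDr !mulrDl !mulNr AA XA -!mulrA XA Xmh !mulr0 oppr0 !addr0.
  by rewrite [A * _ + _]addrC subrK.
have NN' : (1 + M) * (1 - M) = 1.
  by rewrite mulrDl mul1r mulrBr mulr1 MM subr0 subrK.
have N'N : (1 - M) * (1 + M) = 1.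
  by rewrite mulrBl mul1r mulrDr mulr1 MM addr0 addrK.
exists (mk_unit WW' W'W), (mk_unit NN' N'N); rewrite /unit_val /=.
rewrite -addrA [1 + M]addrC addrK [M]addrC addrACA subrr add0r -mulrDr.
by rewrite [h + g]addrC gDh mulr1.
Qed.

(** * Self-injectivity, hulls and comparability *)

Section Injective.
Variable S : pzRingType.
Hypotheses (regS : von_neumann_regular S) (injS : right_self_injective S).
Local Notation Sm := (S^c^o : lmodType S^c).
Local Notation SSm := ((S^c^o * S^c^o)%type : lmodType S^c).

(** The first projection embeds [G] into [S]; injectivity extends the second projection along it to
    a right linear endomorphism of [S], which is left multiplication by the image of 1. *)
Lemma submodule_graph_mull (G : set SSm) : submodule G ->
  (forall b, G (0, b) -> b = 0) ->
  exists s : S, forall a b : S, G (a, b) -> b = s * a.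
Proof.
move=> subG funG.
pose M : lmodType S^c := submod subG.
pose j : {linear M -> SSm} := val.
pose p1 : {linear SSm -> Sm} := fst.
pose p2 : {linear SSm -> Sm} := snd.
pose i : {linear M -> Sm} := (p1 \o j).
pose f : {linear M -> Sm} := (p2 \o j).
have i_inj : injective i.
  move=> x y ixy; apply: val_inj; apply/eqP; rewrite -subr_eq0; apply/eqP.
  have : G (val x - val y).
    rewrite addrC -scaleN1r.
    exact: subG.2 (asboolW (submod_valP y)) (asboolW (submod_valP x)).
  have : (val x - val y).1 = 0 by apply/eqP; rewrite subr_eq0; apply/eqP.
  by case: (val x - val y) => u v /= -> /funG ->.
have [g gP] := injS f i_inj.
exists (g 1) => a b Gab.
have gab : g a = b := gP (Submod (asboolT Gab : mem_submodule subG (a, b))).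
have ga : g a = (a : S^c) *: (g (1 : S) : Sm).
  by rewrite -(linearZ_LR g); congr (g _); exact: esym (mul1r (a : S)).
by rewrite -gab ga.
Qed.

Definition right_ideal (J : set S) : Prop :=
  J 0 /\ forall r x y, J x -> J y -> J (x * r + y).

Definition right_submodule2 (G : S -> S -> Prop) : Prop :=
  G 0 0 /\ forall r a b a' b', G a b -> G a' b' -> G (a * r + a') (b * r + b').

Lemma functional_graph_mull (G : S -> S -> Prop) : right_submodule2 G ->
  (forall b, G 0 b -> b = 0) -> exists s, forall a b, G a b -> b = s * a.
Proof.
move=> [G0 GD] funG.
apply: (@submodule_graph_mull (fun ab => G ab.1 ab.2)) => //.
by split=> // r [a b] [a' b']; apply: GD.
Qed.

Lemma right_ideal_avoiding (B : set S) : ~ B 0 ->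
  exists N, [/\ right_ideal N, forall x, N x -> ~ B x &
    forall x, ~ N x -> exists r y, N y /\ B (x * r + y)].
Proof. exact: (@maximal_submodule_avoiding _ Sm). Qed.

Lemma submodule2_avoiding (B : S -> S -> Prop) : ~ B 0 0 ->
  exists G, [/\ right_submodule2 G, forall a b, G a b -> ~ B a b &
    forall a b, ~ G a b ->
      exists r a' b', G a' b' /\ B (a * r + a') (b * r + b')].
Proof.
move=> B0.
have [N [[N0 linN] NB maxN]] :=
  @maximal_submodule_avoiding _ SSm (fun ab => B ab.1 ab.2) B0.
exists (fun a b => N (a, b)); split=> [|a b|a b].
- by split=> // r a b a' b'; apply: linN.
- exact: NB.
by move=> /maxN [r [[a' b'] H]]; exists r, a', b'.
Qed.

(* The element [t] is an idempotent generating the injective hull of the right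
   ideal spanned by [X]; nonsingularity of [S] is the second property. *)
Lemma hull (X : set S) : exists t,
  (forall x, X x -> t * x = x) /\
  (forall z, (forall x, X x -> z * x = 0) -> z * t = 0).
Proof.
pose J x := forall I, right_ideal I -> (forall y, X y -> I y) -> I x.
have XJ x : X x -> J x by move=> Xx I _; apply.
have J0 : J 0 by move=> I [].
have linJ r x y : J x -> J y -> J (x * r + y).
  by move=> Jx Jy I rI XI; apply: rI.2; [apply: Jx|apply: Jy].
have annJ z : (forall x, X x -> z * x = 0) -> forall x, J x -> z * x = 0.
  move=> zX x Jx; apply: (Jx (fun x => z * x = 0)) => //.
  by split=> [|r a b za zb]; rewrite ?mulr0 // mulrDr mulrA za zb mul0r addr0.
(* [L] is maximal with zero intersection with [J], so [J + L] is essential; [t] will extend the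
   projection of [J + L] onto [J] along [L]. *)
have [|L [[L0 linL] LJ maxL]] := @right_ideal_avoiding (fun x => J x /\ x <> 0).
  by case.
have [|b [Jb Lb]|t tP] := @functional_graph_mull (fun a b => J b /\ L (a - b)).
- split=> [|r a b a' b' [Jb Lb] [Jb' Lb']]; first by rewrite subr0.
  split; first exact: linJ.
  by rewrite opprD addrACA -mulrBl; apply: linL.
- apply: contrapT => b0; apply: (LJ b) => //.
  by move: Lb => /(linL (-1) _ 0)/(_ L0); rewrite sub0r mulrN1 opprK addr0.
have tJ x : J x -> t * x = x by move=> Jx; rewrite -(tP x x) ?subrr.
have tL x : L x -> t * x = 0 by move=> Lx; rewrite -(tP x 0) ?subr0.
exists t; split=> [x /XJ/tJ //|z /annJ zJ].
apply: contrapT => w0; set w := z * t in w0.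
(* [w] kills [J + L], but is injective on the right ideal of the idempotent [w' * w]; essentiality
   then forces [w = 0]. *)
have [w' ww'w] := regS w.
have wJ x : J x -> w * x = 0 by move=> Jx; rewrite -mulrA tJ // zJ.
have wL x : L x -> w * x = 0 by move=> Lx; rewrite -mulrA tL // mulr0.
have wh : w * (w' * w) = w by rewrite mulrA.
have [Lh|] := pselect (L (w' * w)); first by apply: w0; rewrite -wh wL.
move=> /maxL [r [l [Ll [Jhl hl0]]]].
have := wJ _ Jhl; rewrite mulrDr (wL l) // addr0 mulrA wh => wr0.
by move: Jhl hl0; rewrite -mulrA wr0 mulr0 add0r => Jl l0; apply: (LJ l).
Qed.

(** The [x] with [c S x = 0] form a two-sided ideal that contains its own hull [e], and an
    idempotent generating a two-sided ideal of a regular ring is central. *)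
Lemma central_separation (c k : S) : (forall s, c * s * k = 0) ->
  exists e, [/\ forall s, e * s = s * e, e * e = e, e * k = k & c * e = 0].
Proof.
move=> csk.
have [e [eJ annJ]] := hull (fun x => forall s, c * s * x = 0).
have ce s : c * s * e = 0 by apply: annJ => x; apply.
have ese s : e * (s * e) = s * e by apply: eJ => r; rewrite mulrA -(mulrA c) ce.
exists e; split=> [s|||]; last 3 first.
- by rewrite -{2}[e]mul1r ese mul1r.
- exact: eJ.
- by rewrite -[c]mulr1 ce.
have ses z : (1 - e) * (z * e) = 0 by rewrite mulrBl mul1r ese subrr.
have [z] := regS (e * s * (1 - e)); set w := e * s * (1 - e) => wzw.
suff /eqP : w = 0 by rewrite /w mulrBr mulr1 subr_eq0 -mulrA ese => /eqP.
rewrite -wzw.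
have -> : w * z * w = e * s * ((1 - e) * (z * e)) * (s * (1 - e)).
  by rewrite /w !mulrA.
by rewrite ses mulr0 mul0r.
Qed.

(** A nonzero element of [(c - u v) S (k - v u)] would, by regularity, give an isomorphism between
    nonzero submodules of the complements, and so enlarge a maximal partial isomorphism from [k S]
    to [c S]. *)
Lemma comparability (k c : S) : k * k = k -> c * c = c ->
  exists u v, [/\ c * u = u /\ u * k = u, k * v = v /\ v * c = v,
    u * v * u = u, v * u * v = v &
    forall s, (c - u * v) * s * (k - v * u) = 0].
Proof.
move=> kk cc.
(* A submodule of S x S avoiding [B] is the graph of an isomorphism from a
   submodule of kS onto a submodule of cS. *)
pose B a b :=
  [\/ ~ (k * a = a /\ c * b = b), a = 0 /\ b <> 0 | a <> 0 /\ b = 0].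
have B0 : ~ B 0 0 by rewrite /B !mulr0; case=> [[]|[]|[]].
have [G [[G0 linG] GB maxG]] := submodule2_avoiding B0.
have Gkc a b : G a b -> k * a = a /\ c * b = b.
  by move=> /GB nB; apply: contrapT => kc; apply: nB; constructor 1.
have Gfun b : G 0 b -> b = 0.
  by move=> /GB nB; apply: contrapT => b0; apply: nB; constructor 2.
have Ginj a : G a 0 -> a = 0.
  by move=> /GB nB; apply: contrapT => a0; apply: nB; constructor 3.
have [s sP] := functional_graph_mull (conj G0 linG) Gfun.
have [|s' s'P] := @functional_graph_mull (fun b a => G a b) _ Ginj.
  by split=> // r a b a' b'; apply: linG.
have [p [pD annD]] := hull (fun a => exists b, G a b).
have [q [qR annR]] := hull (fun b => exists a, G a b).
have eqD y z : (forall a b, G a b -> y * a = z * a) -> y * p = z * p.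
  move=> yz; apply/eqP; rewrite -subr_eq0 -mulrBl; apply/eqP/annD => a [b Gab].
  by rewrite mulrBl (yz a b) ?subrr.
have eqR y z : (forall a b, G a b -> y * b = z * b) -> y * q = z * q.
  move=> yz; apply/eqP; rewrite -subr_eq0 -mulrBl; apply/eqP/annR => b [a Gab].
  by rewrite mulrBl (yz a b) ?subrr.
have pG a b : G a b -> p * a = a by move=> Gab; apply: pD; exists b.
have qG a b : G a b -> q * b = b by move=> Gab; apply: qR; exists a.
have kp : k * p = p.
  by rewrite -[RHS]mul1r; apply: eqD => a b /Gkc[-> _]; rewrite mul1r.
have cq : c * q = q.
  by rewrite -[RHS]mul1r; apply: eqR => a b /Gkc[_ ->]; rewrite mul1r.
have pp : p * p = p.
  by rewrite -[RHS]mul1r; apply: eqD => a b /pG->; rewrite mul1r.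
have qq : q * q = q.
  by rewrite -[RHS]mul1r; apply: eqR => a b /qG->; rewrite mul1r.
have csp : c * s * p = s * p.
  by apply: eqD => a b Gab; rewrite -mulrA -(sP a b Gab) (Gkc a b Gab).2.
have qsp : q * s * p = s * p.
  by apply: eqD => a b Gab; rewrite -mulrA -(sP a b Gab) (qG a b Gab).
have ksq : k * s' * q = s' * q.
  by apply: eqR => a b Gab; rewrite -mulrA -(s'P b a Gab) (Gkc a b Gab).1.
have psq : p * s' * q = s' * q.
  by apply: eqR => a b Gab; rewrite -mulrA -(s'P b a Gab) (pG a b Gab).
have s'sp : s' * s * p = p.
  rewrite -[RHS]mul1r; apply: eqD => a b Gab.
  by rewrite -mulrA -(sP a b Gab) -(s'P b a Gab) ?mul1r.
have ss'q : s * s' * q = q.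
  rewrite -[RHS]mul1r; apply: eqR => a b Gab.
  by rewrite -mulrA -(s'P b a Gab) -(sP a b Gab) ?mul1r.
have uv : s * p * k * (s' * q * c) = q * c.
  rewrite mulrA -(mulrA (s * p)) (mulrA k) ksq.
  by rewrite -(mulrA s) (mulrA p) psq mulrA ss'q.
have vu : s' * q * c * (s * p * k) = p * k.
  rewrite mulrA -(mulrA (s' * q)) (mulrA c) csp.
  by rewrite -(mulrA s') (mulrA q) qsp mulrA s'sp.
(* The right factors [k] and [c] make [v u = p k] and [u v = q c] idempotents below [k] and [c]. *)
exists (s * p * k), (s' * q * c); rewrite uv vu; split.
- by split; rewrite ?mulrA ?csp // -mulrA kk.
- by split; rewrite ?mulrA ?ksq // -mulrA cc.
- by rewrite -(mulrA q) 2!(mulrA c) csp !mulrA qsp.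
- by rewrite -(mulrA p) 2!(mulrA k) ksq !mulrA psq.
move=> t; apply: contrapT; set k' := k - p * k; set c' := c - q * c.
have kk' : k * k' = k' by rewrite mulrBr mulrA kk kp.
have cc' : c * c' = c' by rewrite mulrBr mulrA cc cq.
have pk' : p * k' = 0 by rewrite mulrBr mulrA pp subrr.
have qc' : q * c' = 0 by rewrite mulrBr mulrA qq subrr.
have k'k' : k' * k' = k' by rewrite {1}/k' mulrBl -mulrA kk' pk' subr0.
move: (c' * t * k') (mulrA c' t k') => w def_w w0.
have wk' : w * k' = w by rewrite -def_w -!mulrA k'k'.
have cw : c * w = w by rewrite -def_w mulrA cc'.
have qw : q * w = 0 by rewrite -def_w mulrA qc' mul0r.
have [w' ww'w] := regS w.
(* [h r] and [w r] vanish together, so [(h, w)] generates the graph of an isomorphism; it is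
   independent of [G] because [p] kills [h] and [q] kills [w]. *)
pose h := k' * w' * w.
have wh : w * h = w by rewrite /h !mulrA wk'.
have ph : p * h = 0 by rewrite /h !mulrA pk' !mul0r.
have kh : k * h = h by rewrite /h !mulrA kk'.
have [Ghw|] := pselect (G h w).
  by apply: w0; rewrite -wh -(pG _ _ Ghw) ph mulr0.
move=> /maxG[r [a [b [Gab]]]]; have [ka cb] := Gkc a b Gab.
case=> [[]|[ha0 wb0]|[ha0 wb0]].
- by rewrite !mulrDr (mulrA k) kh (mulrA c) cw ka cb.
- have a0 : a = 0.
    have : p * (h * r + a) = 0 by rewrite ha0 mulr0.
    by rewrite mulrDr mulrA ph mul0r add0r (pG a b Gab).
  have b0 : b = 0 by apply: Gfun; rewrite -{1}a0.
  apply: wb0; rewrite b0 addr0 -wh -mulrA.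
  by move: ha0; rewrite a0 addr0 => ->; rewrite mulr0.
- have b0 : b = 0.
    have : q * (w * r + b) = 0 by rewrite wb0 mulr0.
    by rewrite mulrDr mulrA qw mul0r add0r (qG a b Gab).
  have a0 : a = 0 by apply: Ginj; rewrite -{1}b0.
  apply: ha0; rewrite a0 addr0 /h -mulrA.
  by move: wb0; rewrite b0 addr0 => ->; rewrite mulr0.
Qed.

(** * Inner inverses as products of one-sided invertible elements *)

Lemma central_idempotent_mul (e : S) : (forall s, e * s = s * e) -> e * e = e ->
  forall x y x' y', (e * x + (1 - e) * y) * (e * x' + (1 - e) * y') =
    e * (x * x') + (1 - e) * (y * y').
Proof.
move=> eC ee x y x' y'.
have ef : e * (1 - e) = 0 by rewrite mulrBr mulr1 ee subrr.
have fC s : (1 - e) * s = s * (1 - e) by rewrite mulrBl mulrBr mul1r mulr1 eC.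
have fe : (1 - e) * e = 0 by rewrite fC.
have ff : (1 - e) * (1 - e) = 1 - e by rewrite {1}mulrBl mul1r ef subr0.
rewrite mulrDl !mulrDr (eC x) (fC y) -!mulrA !(mulrA e) !(mulrA (1 - e)).
rewrite ee ef fe ff !mul0r !mulr0 addr0 add0r.
by rewrite !(mulrA _ e) !(mulrA _ (1 - e)) -eC -fC -!mulrA.
Qed.

Lemma inner_inverse_product (a : S) :
  exists x x' y y', [/\ x' * x = 1, y * y' = 1 & a * (x * y) * a = a].
Proof.
(* This choice also satisfies [a' a a' = a'], which kills the cross terms [a' u] and [u a']
   below. *)
have [a0 aa0a] := regS a; pose a' := a0 * a * a0.
have aa'a : a * a' * a = a by rewrite /a' !mulrA !aa0a.
have a'aa' : a' * a * a' = a'.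
  have -> : a' * a * a' = a0 * (a * a0 * a * a0 * a) * a0 by rewrite /a' !mulrA.
  by rewrite !aa0a.
clearbody a'.
have kk : (1 - a' * a) * (1 - a' * a) = 1 - a' * a.
  by rewrite mulrBl mul1r mulrBr mulr1 mulrA a'aa' subrr subr0.
have cc : (1 - a * a') * (1 - a * a') = 1 - a * a'.
  by rewrite mulrBl mul1r mulrBr mulr1 mulrA aa'a subrr subr0.
have ak : a * (1 - a' * a) = 0 by rewrite mulrBr mulr1 mulrA aa'a subrr.
have ca : (1 - a * a') * a = 0 by rewrite mulrBl mul1r aa'a subrr.
have a'c : a' * (1 - a * a') = 0 by rewrite mulrBr mulr1 mulrA a'aa' subrr.
have ka' : (1 - a' * a) * a' = 0 by rewrite mulrBl mul1r a'aa' subrr.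
have [u [v [[cu uk] [kv vc] uvu vuv]]] := comparability kk cc.
move=> /central_separation[e [e_central ee]]; set k' := _ - v * u.
set c' := _ - u * v => ek' c'e.
pose b := a' + v; pose w := a + u.
have bw : b * w = 1 - k'.
  rewrite mulrDl !mulrDr -{1}cu (mulrA a') a'c mul0r addr0.
  rewrite -{1}vc -(mulrA v) ca mulr0 add0r.
  by rewrite /k' -addrA -opprD subKr.
have wb : w * b = 1 - c'.
  rewrite mulrDl !mulrDr -{1}kv (mulrA a) ak mul0r addr0.
  rewrite -{1}uk -(mulrA u) ka' mulr0 add0r.
  by rewrite /c' -addrA -opprD subKr.
have mulE := central_idempotent_mul e_central ee.
(* [c'] vanishes on [e S], so [w b = 1] there; [k'] vanishes on [(1 - e) S], so [b w = 1] there.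
   Each factor is [b] on one part and 1 on the other, whence [x y = b]. *)
exists (e * b + (1 - e) * 1), (e * w + (1 - e) * 1).
exists (e * 1 + (1 - e) * b), (e * 1 + (1 - e) * w).
rewrite !mulE !mulr1 !mul1r.
have addeC : e + (1 - e) = 1 by rewrite addrC subrK.
split.
- by rewrite wb mulrBr mulr1 e_central c'e subr0.
- by rewrite bw mulrBr mulr1 mulrBl mul1r ek' subrr subr0.
rewrite -mulrDl addeC mul1r mulrDr mulrDl aa'a -[RHS]addr0; congr (_ + _).
by rewrite -vc -!mulrA ca !mulr0.
Qed.

(** * Shifts, and one-sided inverses as sums of units *)

Lemma independent_extension (x y f : S) (s : nat -> S) :
    y * x = 1 -> y * f = 0 -> f * x = 0 -> f * f = f ->
    (forall i, s i * f = s i) ->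
  exists t, forall i, t * (x ^+ i * f) = s i.
Proof.
move=> yx yf fx ff sf.
have yxn i : y ^+ i * x ^+ i = 1.
  elim: i => [|i IHi]; first by rewrite !expr0 mulr1.
  by rewrite exprSr exprS mulrA -(mulrA _ y) yx mulr1.
(* Hence the right ideals [x^i f S] are independent, and the images of their generators can be
   prescribed subject only to [s i * f = s i]. *)
have coordE i j : f * y ^+ i * (x ^+ j * f) = if i == j then f else 0.
  case: ltngtP => [ij|ji|->]; last by rewrite -mulrA (mulrA _ _ f) yxn mul1r.
    rewrite -(subnKC ij) addSnnS exprD mulrA -(mulrA f) -(mulrA _ (_ * _)).
    by rewrite -!mulrA (mulrA _ _ (_ * f)) yxn mul1r exprS !mulrA fx !mul0r.
  rewrite -(subnK ji) addnS -addSn exprD -!mulrA (mulrA (y ^+ j)) yxn mul1r.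
  by rewrite exprSr -mulrA yf !mulr0.
(* [f * y ^+ i] reads off the i-th coordinate, so the pairs in [G] need not
   carry their coefficients. *)
pose G a b := exists n, forall m, (n <= m)%N ->
  a = \sum_(i < m) x ^+ i * f * (f * y ^+ i * a) /\
  b = \sum_(i < m) s i * (f * y ^+ i * a).
have [|b [n /(_ n (leqnn n))[_ ->]]|t tP] := @functional_graph_mull G.
- split=> [|r a b a' b' [n nP] [n' n'P]].
    by exists 0%N => m _; split; rewrite big1 // => i _; rewrite !mulr0.
  exists (maxn n n') => m; rewrite geq_max => /andP[/nP[aE bE] /n'P[a'E b'E]].
  split.
    rewrite {1}aE {1}a'E mulr_suml -big_split /=; apply: eq_bigr => i _.
    by rewrite !mulrDr !mulrA.
  rewrite {1}bE {1}b'E mulr_suml -big_split /=; apply: eq_bigr => i _.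
  by rewrite !mulrDr !mulrA.
- by rewrite big1 // => i _; rewrite !mulr0.
exists t => j; apply/esym/tP; exists j.+1 => m jm.
rewrite (bigD1 (Ordinal jm)) //= coordE eqxx -mulrA ff big1 ?addr0; last first.
  by move=> i /negbTE ij; rewrite coordE -val_eqE /= in ij *; rewrite ij mulr0.
split=> //; rewrite (bigD1 (Ordinal jm)) //= coordE eqxx sf big1 ?addr0 //.
by move=> i /negbTE ij; rewrite coordE -val_eqE /= in ij *; rewrite ij mulr0.
Qed.

(** On the generators [e i = x^i (1 - x y)] of the hull, [x] shifts up, [y] shifts down and [A]
    swaps [e (2i)] with [e (2i+1)]. Identities checked on all [e i] hold on [g S] by the second
    property of [hull]. *)
Lemma shift_swap (x y : S) : y * x = 1 ->
  exists g A, [/\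
    [/\ x * g = g * x * g, y * g = g * y * g & 1 - x * y = g * (1 - x * y)],
    [/\ g * g = g, g * A = A, A * g = A & A * A = g],
    (x * g - A) * (x * g - A) = 0 & (y * g - A) * (y * g - A) = 0].
Proof.
move=> yx; pose f := 1 - x * y.
have yf : y * f = 0 by rewrite mulrBr mulr1 mulrA yx mul1r subrr.
have fx : f * x = 0 by rewrite mulrBl mul1r -mulrA yx mulr1 subrr.
have ff : f * f = f by rewrite {1}/f mulrBl mul1r -mulrA yf mulr0 subr0.
pose e i := x ^+ i * f.
have ef i : e i * f = e i by rewrite -mulrA ff.
have xe i : x * e i = e i.+1 by rewrite /e exprS mulrA.
have ye0 : y * e 0%N = 0 by rewrite /e expr0 mul1r.
have yeS i : y * e i.+1 = e i by rewrite -xe mulrA yx mul1r.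
have [g [gX annX]] := hull (fun z => exists i, z = e i).
have ge i : g * e i = e i by apply: gX; exists i.
have eqg z w : (forall i, z * e i = w * e i) -> z * g = w * g.
  move=> zw; apply/eqP; rewrite -subr_eq0 -mulrBl; apply/eqP/annX => _ [i ->].
  by rewrite mulrBl zw subrr.
have gg : g * g = g by rewrite -[RHS]mul1r; apply: eqg => i; rewrite ge mul1r.
pose swap i := if odd i then i.-1 else i.+1.
have [B Be] := independent_extension yx yf fx ff (fun i => ef (swap i)).
pose A := g * B * g.
have Ae i : A * e i = e (swap i) by rewrite -!mulrA ge Be ge.
have gA : g * A = A by rewrite /A !mulrA gg.
have Ag : A * g = A by rewrite -mulrA gg.
have swapK : involutive swap.
  by case=> // i; rewrite /swap /=; case: (odd i) / boolP => /= [->|/negbTE->].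
have xg : g * x * g = x * g by apply: eqg => i; rewrite -mulrA xe ge.
have yg : g * y * g = y * g.
  by apply: eqg => -[|i]; rewrite -mulrA ?ye0 ?mulr0 // yeS ge.
have sqM m : g * m * g = m * g -> (forall i, (m - A) * ((m - A) * e i) = 0) ->
    (m * g - A) * (m * g - A) = 0.
  move=> mg me.
  have gmA : g * (m * g - A) = m * g - A by rewrite mulrBr mulrA mg gA.
  have mAg : m * g - A = (m - A) * g by rewrite mulrBl Ag.
  rewrite {1}mAg -mulrA gmA mAg mulrA -[RHS](mul0r g); apply: eqg => i.
  by rewrite -mulrA me mul0r.
have mAe m i : (m - A) * e i = m * e i - e (swap i) by rewrite mulrBl Ae.
exists g, A; split.
- split=> //; rewrite -/f.
  by have := ge 0%N; rewrite /e expr0 mul1r.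
- split=> //; rewrite -{2}Ag mulrA -[RHS]mul1r; apply: eqg => i.
  by rewrite -mulrA !Ae swapK mul1r.
(* [x - A] kills the even [e i] and sends the odd ones to differences of even ones. *)
- apply: sqM => // i; rewrite mAe xe /swap.
  case: (boolP (odd i)) => [|_]; last by rewrite subrr mulr0.
  case: i => //= i /negbTE oi; rewrite mulrBr !mAe !xe /swap /= oi /=.
  by rewrite !subrr.
(* The parities are reversed for [y - A]; [e 0], which [y] kills, goes to [- e 1]. *)
- apply: sqM => // -[|i]; rewrite mAe /swap ?ye0 ?yeS /=.
    by rewrite sub0r mulrN mAe yeS /swap subrr oppr0.
  case: (boolP (odd i)) => [|_]; last by rewrite subrr mulr0.
  case: i => //= i /negbTE oi; rewrite mulrBr !mAe !yeS /swap /= oi /=.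
  by rewrite !subrr.
Qed.

Lemma one_sided_inverse_unit_sum (x y : S) : y * x = 1 ->
  (exists u v : units S, x = unit_val u + unit_val v - 1) /\
  (exists u v : units S, y = unit_val u + unit_val v - 1).
Proof.
move=> yx; have [g [A [[xg yg gf] [gg gA Ag AA] xM yM]]] := shift_swap yx.
have hh : (1 - g) * (1 - g) = 1 - g.
  by rewrite mulrBl mul1r mulrBr mulr1 gg subrr subr0.
have hxyh : (1 - g) * (x * y) * (1 - g) = 1 - g.
  have hf : (1 - g) * (1 - x * y) = 0 by rewrite mulrBl mul1r -gf subrr.
  by rewrite -[x * y](subKr 1) [X in X * _]mulrBr mulr1 hf subr0.
have hyxh : (1 - g) * (y * x) * (1 - g) = 1 - g by rewrite yx mulr1.
split; first exact: (block_triangular_unit_sum gg gA Ag AA xg yg hxyh hyxh xM).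
exact: (block_triangular_unit_sum gg gA Ag AA yg xg hyxh hxyh yM).
Qed.
End Injective.

Theorem corollary2p6 (S : pzRingType) (n : nat)
    (charS : has_characteristic S n) :
  von_neumann_regular S -> right_self_injective S ->
  von_neumann_regular (units_subring charS).
Proof.
move=> regS injS a; pose phi := unit_eval charS.
have [closed1 closedB closedM] := @in_image_subring _ S phi.
have unitI u : in_image phi (unit_val u).
  by apply/asboolP; eexists; exact: unit_eval_unit.
have sumI z : (exists u v : units S, z = unit_val u + unit_val v - 1) ->
    in_image phi z.
  (* Closure is given for differences, so [u + v - 1] is read as [u - (1 - v)]. *)
  move=> [u [v ->]]; rewrite -addrA -opprB.
  exact: closedB (unitI u) (closedB _ _ closed1 (unitI v)).
have [x [x' [y [y' [x'x yy' axya]]]]] :=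
  inner_inverse_product regS injS (val a).
have [xI _] := one_sided_inverse_unit_sum regS injS x'x.
have [_ yI] := one_sided_inverse_unit_sum regS injS yy'.
exists (RingImage (closedM _ _ (sumI _ xI) (sumI _ yI))).
exact: val_inj.
Qed.
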